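(* Let $f_1,\dots,f_n:\mathbb R^d\to\mathbb R$ be differentiable and suppose that each $f_i$ is $L_i$-smooth, i.e. $\|\nabla f_i(x)-\nabla f_i(y)\|\le L_i\|x-y\|$ for all $x,y\in\mathbb R^d$. Let $L_{\max}=\max_{i\in[n]}L_i$. Then the Functional $(L_A,L_B)$ Inequality holds for $f_1,\dots,f_n$ with $L_A=L_{\max}$ and $L_B=0$.
   Context: $\|\cdot\|$ is the Euclidean norm. The Functional $(L_A,L_B)$ Inequality, for constants $L_A,L_B\ge0$, is: for all $x,u_1,\dots,u_n\in\mathbb R^d$, $$\Big\|\frac1n\sum_{i=1}^n(\nabla f_i(x+u_i)-\nabla f_i(x))\Big\|^2\le L_A^2\Big(\frac1n\sum_{i=1}^n\|u_i\|^2\Big)+L_B^2\Big\|\frac1n\sum_{i=1}^nu_i\Big\|^2.$$ *)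

(* Defs.v *)
From HB Require Import structures.
From mathcomp Require Import all_boot all_order all_algebra.
From mathcomp Require Import all_classical all_reals all_analysis.

Set Implicit Arguments.
Unset Strict Implicit.
Unset Printing Implicit Defensive.

Import Order.TTheory GRing.Theory Num.Theory.
Import numFieldNormedType.Exports.

Local Open Scope ring_scope.

(* The library norm `|x| on 'rV[R]_d is the sup norm, so the Euclidean norm is
   defined here. Differentiability does not depend on this choice. *)
Definition enorm (R : realType) (d : nat) (x : 'rV[R]_d) : R :=
  Num.sqrt (\sum_(j < d) x 0 j ^+ 2).

(* The vector of partial derivatives; the derivative is total, so this is
   meaningful only where f is differentiable. *)
Definition grad (R : realType) (d : nat) (f : 'rV[R]_d -> R) (x : 'rV[R]_d) :
    'rV[R]_d :=
  \row_(j < d) 'D_(delta_mx 0 j) f x.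

Definition smooth (R : realType) (d : nat) (L : R) (f : 'rV[R]_d -> R) : Prop :=
  forall x y : 'rV[R]_d, enorm (grad f x - grad f y) <= L * enorm (x - y).

Definition functional_ineq (R : realType) (n d : nat)
    (f : 'I_n -> 'rV[R]_d -> R) (LA LB : R) : Prop :=
  [/\ 0 <= LA, 0 <= LB &
   forall (x : 'rV[R]_d) (u : 'I_n -> 'rV[R]_d),
     enorm (n%:R^-1 *: \sum_(i < n) (grad (f i) (x + u i) - grad (f i) x)) ^+ 2
     <= LA ^+ 2 * (n%:R^-1 * \sum_(i < n) enorm (u i) ^+ 2)
        + LB ^+ 2 * enorm (n%:R^-1 *: \sum_(i < n) u i) ^+ 2].

(* Main.v *)
(* By convexity of the square, the squared norm of a mean is at most the mean of
   the squared norms; each summand is then bounded by smoothness. *)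
Require Import Defs.
From HB Require Import structures.
From mathcomp Require Import all_boot all_order all_algebra.
From mathcomp Require Import all_classical all_reals all_analysis.
From mathcomp Require Import ring lra.

Set Implicit Arguments.
Unset Strict Implicit.
Unset Printing Implicit Defensive.

Import Order.TTheory GRing.Theory Num.Theory.
Import numFieldNormedType.Exports.

Local Open Scope ring_scope.

(** Jensen's inequality for the square, [sqr_mean_le], passes to vectors coordinate by coordinate in
    [sqr_enorm_mean_le]. Applied to the gradient increments, it leaves a mean of squares, each at
    most [L i ^+ 2 * enorm (u i) ^+ 2]. Replacing [L i] by the maximum must preserve squares, so
    signs matter: [smooth_const_ge0] supplies them. *)

Section EuclideanNorm.
Variables (R : realType) (d : nat).
Implicit Types x : 'rV[R]_d.

Lemma enorm_ge0 x : 0 <= enorm x.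
Proof. exact: sqrtr_ge0. Qed.

Lemma sqr_enorm x : enorm x ^+ 2 = \sum_(j < d) x 0 j ^+ 2.
Proof. by rewrite sqr_sqrtr// sumr_ge0// => j _; exact: sqr_ge0. Qed.

Lemma enorm_gt0 x : x != 0 -> 0 < enorm x.
Proof.
move=> x0; rewrite sqrtr_gt0 lt0r sumr_ge0 ?andbT => [|j _]; last exact: sqr_ge0.
apply: contra x0 => /eqP/psumr_eq0P s0; apply/eqP/rowP => j; rewrite mxE.
by apply/eqP; rewrite -sqrf_eq0 s0// => k _; exact: sqr_ge0.
Qed.

End EuclideanNorm.

Lemma sqr_mean_le (R : realFieldType) (n : nat) (a : 'I_n -> R) : (0 < n)%N ->
  (n%:R^-1 * \sum_(i < n) a i) ^+ 2 <= n%:R^-1 * \sum_(i < n) a i ^+ 2.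
Proof.
move=> n_gt0; set m := _ * _.
have n0 : n%:R != 0 :> R by rewrite pnatr_eq0 -lt0n.
(* Sum the tangent-line bounds for the square at the mean [m]. *)
have tangent : \sum_(i < n) (2 * m * a i - m ^+ 2) <= \sum_(i < n) a i ^+ 2.
  by apply: ler_sum => i _; have := sqr_ge0 (a i - m); nra.
(* As [m] is the mean of the [a i], the tangent values average to [2 * m * m - m ^+ 2]. *)
have -> : m ^+ 2 = n%:R^-1 * \sum_(i < n) (2 * m * a i - m ^+ 2).
  rewrite sumrB -mulr_sumr sumr_const card_ord -[m ^+ 2 *+ n]mulr_natl mulrBr mulKf//.
  by rewrite mulrCA -/m; ring.
by rewrite ler_wpM2l// invr_ge0.
Qed.

Lemma sqr_enorm_mean_le (R : realType) (n d : nat) (v : 'I_n -> 'rV[R]_d) :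
  (0 < n)%N ->
  enorm (n%:R^-1 *: \sum_(i < n) v i) ^+ 2
  <= n%:R^-1 * \sum_(i < n) enorm (v i) ^+ 2.
Proof.
move=> n_gt0; rewrite sqr_enorm.
rewrite (eq_bigr _ (fun i _ => sqr_enorm (v i))) exchange_big mulr_sumr; apply: ler_sum => j _.
by rewrite mxE summxE; exact: sqr_mean_le.
Qed.

(** Smoothness is tested on two distinct points, the all-ones vector and 0. In dimension 0 no such
    pair exists and a negative [L] would pass. *)
Lemma smooth_const_ge0 (R : realType) (d : nat) (L : R) (f : 'rV[R]_d -> R) :
  (0 < d)%N -> smooth L f -> 0 <= L.
Proof.
case: d f => // d f _ /(_ (const_mx 1) 0); rewrite subr0 => Lf.
have e_gt0 : 0 < enorm (const_mx 1 : 'rV[R]_d.+1).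
  by apply/enorm_gt0/eqP => /rowP/(_ 0)/eqP; rewrite !mxE oner_eq0.
by rewrite -(pmulr_lge0 _ e_gt0); apply: le_trans Lf; exact: enorm_ge0.
Qed.

Theorem theorem4p4 (R : realType) (n d : nat) (n_gt0 : (0 < n)%N)
    (d_gt0 : (0 < d)%N) (f : 'I_n -> 'rV[R]_d -> R) (L : 'I_n -> R)
    (f_diff : forall (i : 'I_n) (x : 'rV[R]_d), differentiable (f i) x)
    (f_smooth : forall i : 'I_n, smooth (L i) (f i)) :
  functional_ineq f (\big[Num.max/L (Ordinal n_gt0)]_(i < n) L i) 0.
Proof.
(* The default value of this maximum is itself one of the [L i], so [M] is their true maximum. *)
set M := \big[_/_]_(i < n) _.
have L_ge0 i : 0 <= L i := smooth_const_ge0 d_gt0 (f_smooth i).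
have L_le i : L i <= M by exact: le_bigmax.
have M_ge0 : 0 <= M := le_trans (L_ge0 (Ordinal n_gt0)) (L_le _).
split=> // x u; rewrite expr0n mul0r addr0.
apply: le_trans (sqr_enorm_mean_le _ n_gt0) _.
(* Cancelling the common factor [n%:R^-1] leaves a termwise comparison. *)
rewrite mulrCA ler_wpM2l ?invr_ge0// mulr_sumr; apply: ler_sum => i _.
rewrite -exprMn ler_sqr ?nnegrE ?mulr_ge0 ?enorm_ge0//.
apply: le_trans (f_smooth i _ _) _.
by rewrite addrAC subrr add0r ler_wpM2r ?enorm_ge0.
Qed.
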